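(* Let $Q,B,\Psi,r,\mu_0\in\mathbb{R}$ and $\sigma,\sigma_0>0$ be constants with $Q>0$, $C:=Q+B>0$ and $\sqrt{C}=2\Psi$. For each horizon $T>0$, let $(u,m)=(u^T,m^T)$ be the quadratic-in-space solution (described in the context) of the finite horizon linear-quadratic mean field game on $[0,T]$ with state space $\mathbb{R}$, running cost $\frac12 a^2+\frac12\big(Qx^2+B(x-\int \xi\, m_t(d\xi))^2\big)$, terminal cost $\Psi(x-r)^2$ and Gaussian initial distribution $\mathcal{N}(\mu_0,\sigma_0)$, and let $\mu_t=\int_{\mathbb{R}}\xi\,m_t(d\xi)$ be the mean of the equilibrium distribution at time $t$. Let $$\overline{u}(x)=\tfrac12\sqrt{C}\,x^2,\qquad \overline{m}(dx)=\frac{1}{\sqrt{\pi s\sigma^2}}\exp\Big(-\frac{x^2}{s\sigma^2}\Big)dx,\qquad s=\frac{1}{\sqrt{C}},$$ be the quadratic-Gaussian solution of the corresponding ergodic problem. Then there exists a constant $K>0$, independent of $t$ and $T$ (but possibly depending on $Q,B,\Psi,r,\mu_0,\sigma$), such that for every $T>0$ and every $t\in[0,T]$, $$\int_{\mathbb{R}} |u(t,x)-u(t,0)-\overline{u}(x)|\,\overline{m}(dx)\le K\big(e^{-\sqrt{C-B}\,t}+e^{-\sqrt{C-B}\,(T-t)}\big),$$ $$\int_{\mathbb{R}} |\partial_x u(t,x)-\partial_x\overline{u}(x)|\,\overline{m}(dx)\le K\big(e^{-\sqrt{C-B}\,t}+e^{-\sqrt{C-B}\,(T-t)}\big),$$ $$|\mu_t|\le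 K\big(e^{-\sqrt{C-B}\,t}+e^{-\sqrt{C-B}\,(T-t)}\big).$$
   Context: A representative agent has one-dimensional state $dX_t=-\alpha_t\,dt+\sigma\,dW_t$, with $X_0$ distributed as $\mathcal{N}(\mu_0,\sigma_0)$ (mean $\mu_0$), and minimizes the expected running cost plus terminal cost against a flow $(m_t)_{0\le t\le T}$ of probability measures, which in equilibrium is the flow of marginal laws of $X_t$. The finite horizon mean field game system is $$-\partial_t u-\tfrac{\sigma^2}{2}\partial_{xx}u+\tfrac12|\partial_x u|^2=\tfrac12\big(Qx^2+B(x-\mu_t)^2\big),\qquad u(T,x)=\Psi(x-r)^2,$$ $$\partial_t m-\tfrac{\sigma^2}{2}\partial_{xx}m-\partial_x(m\,\partial_x u)=0,\qquad m(0,\cdot)=\mathcal{N}(\mu_0,\sigma_0),\qquad \mu_t=\int_{\mathbb{R}}\xi\,m_t(d\xi).$$ The solution considered is the one of the form $u(t,x)=\frac12\phi_t x^2+\chi_t x+\psi_t$, where $(\mu,\phi,\chi,\psi)$ solves on $[0,T]$ the forward-backward ODE system $$\dot\mu_t=-(\phi_t\mu_t+\chi_t),\quad \mu_t|_{t=0}=\mu_0;\qquad \dot\phi_t=\phi_t^2-(Q+B),\quad \phi_T=2\Psi;$$ $$\dot\chi_t=\phi_t\chi_t+B\mu_t,\quad \chi_T=-2\Psi r;\qquad -\dot\psi_t=\tfrac{\sigma^2}{2}\phi_t-\tfrac12\chi_t^2+\tfrac12 B\mu_t^2,\quad \psi_T=\Psi r^2.$$ The ergodic problem is the time-independent (stationary)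 version with the same state dynamics and running cost, minimizing the long-time average cost. Its quadratic-Gaussian solution is $(\overline u,\overline m)$ as given explicitly in the claim; $\overline m$ is a centered Gaussian law with variance $\sigma^2/(2\sqrt{C})$. *)

(* Defs.v *)
From HB Require Import structures.
From mathcomp Require Import all_boot all_order all_algebra.
From mathcomp Require Import all_classical all_reals all_analysis.
From mathcomp Require Import measurable_realfun.

Set Implicit Arguments.
Unset Strict Implicit.
Unset Printing Implicit Defensive.

Import Order.TTheory GRing.Theory Num.Theory.
Import numFieldNormedType.Exports.

Local Open Scope classical_set_scope.
Local Open Scope ring_scope.

Section finite_horizon.
Context {R : realType}.
Implicit Types (T t x : R) (u rho f : R -> R -> R).
Implicit Types m : R -> probability (measurableTypeR R) R.

Definition mean (P : probability (measurableTypeR R) R) : R := \int[P]_x x.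

Definition d_t f t x : R := derive1 (f ^~ x) t.
Definition d_x f t x : R := derive1 (f t) x.
Definition d_xx f t x : R := derive1n 2 (f t) x.

(* [y' = F] on the horizon, up to the end points: [y] is continuous on [0, T]
   and differentiable inside; the values of [y] outside [0, T] are
   irrelevant. *)
Definition ode_on T (y F : R -> R) : Prop :=
  {within `[0, T], continuous y} /\
  forall t, t \in `]0, T[ -> is_derive t 1 y (F t).

(* Makes [d_t f], [d_x f], [d_xx f] genuine derivatives ([derive1] is total), and
   the conditions imposed at the times [0] and [T] genuine boundary conditions. *)
Record classical_on T f : Prop := ClassicalOn {
  classical_continuous :
    {within [set z : R * R | z.1 \in `[0, T]], continuous (fun z => f z.1 z.2)};
  classical_dt : forall t x, t \in `]0, T[ -> derivable (f ^~ x) t 1;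
  classical_dx : forall t x, t \in `]0, T[ -> derivable (f t) x 1;
  classical_dxx : forall t x, t \in `]0, T[ -> derivable (d_x f t) x 1
}.

(* Hamilton-Jacobi-Bellman / Fokker-Planck system; [rho t] is the density with
   respect to the Lebesgue measure of the probability [m t]. [sigma0] is
   a standard deviation, as in [normal_prob]. *)
Record mfg_solution (Q B Psi r mu0 sigma sigma0 T : R) u m rho : Prop :=
  MfgSolution {
  mfg_u_classical : classical_on T u;
  mfg_hjb : forall t x, t \in `]0, T[ ->
    - d_t u t x - sigma ^+ 2 / 2 * d_xx u t x
      + 2^-1 * d_x u t x ^+ 2
    = 2^-1 * (Q * x ^+ 2 + B * (x - mean (m t)) ^+ 2);
  mfg_terminal : forall x, u T x = Psi * (x - r) ^+ 2;
  mfg_m_density : forall t, t \in `[0, T] ->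
    (forall x, 0 <= rho t x) /\
    forall A, measurable A ->
      m t A = (\int[lebesgue_measure]_(x in A) (rho t x)%:E)%E;
  mfg_m_mean : forall t, t \in `[0, T] -> (m t).-integrable setT EFin;
  mfg_rho_classical : classical_on T rho;
  mfg_fp : forall t x, t \in `]0, T[ ->
    d_t rho t x - sigma ^+ 2 / 2 * d_xx rho t x
      - d_x (fun t' y => rho t' y * d_x u t' y) t x = 0;
  mfg_initial : forall A, measurable A -> m 0 A = normal_prob mu0 sigma0 A
}.

Record quadratic_odes (Q B Psi r mu0 sigma T : R) (mu phi chi psi : R -> R)
  : Prop := QuadraticOdes {
  ode_mu : ode_on T mu (fun t => - (phi t * mu t + chi t));
  ode_mu0 : mu 0 = mu0;
  ode_phi : ode_on T phi (fun t => phi t ^+ 2 - (Q + B));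
  ode_phiT : phi T = 2 * Psi;
  ode_chi : ode_on T chi (fun t => phi t * chi t + B * mu t);
  ode_chiT : chi T = - (2 * Psi * r);
  ode_psi : ode_on T psi (fun t =>
    - (sigma ^+ 2 / 2 * phi t - 2^-1 * chi t ^+ 2 + 2^-1 * B * mu t ^+ 2));
  ode_psiT : psi T = Psi * r ^+ 2
}.

Definition quadratic_mfg_solution (Q B Psi r mu0 sigma sigma0 T : R) u m : Prop :=
  (exists rho, mfg_solution Q B Psi r mu0 sigma sigma0 T u m rho) /\
  exists mu phi chi psi : R -> R,
    [/\ quadratic_odes Q B Psi r mu0 sigma T mu phi chi psi,
        forall t, t \in `[0, T] -> mu t = mean (m t)
      & forall t x, t \in `[0, T] ->
          u t x = 2^-1 * phi t * x ^+ 2 + chi t * x + psi t].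

End finite_horizon.

Section ergodic.
Context {R : realType}.
Variables C sigma : R.

Definition ergodic_u (x : R) : R := 2^-1 * Num.sqrt C * x ^+ 2.

Definition ergodic_density (x : R) : R :=
  let s := 1 / Num.sqrt C in
  1 / Num.sqrt (pi * s * sigma ^+ 2) * expR (- (x ^+ 2 / (s * sigma ^+ 2))).

Definition ergodic_m : set (measurableTypeR R) -> \bar R :=
  fun A => (\int[lebesgue_measure]_(x in A) (ergodic_density x)%:E)%E.

Lemma ergodic_density_ge0 x : 0 <= ergodic_density x.
Proof. by rewrite mulr_ge0 ?expR_ge0// divr_ge0 ?sqrtr_ge0. Qed.

Lemma measurable_ergodic_density : measurable_fun setT ergodic_density.
Proof.
apply: measurable_funM => //; apply: measurableT_comp => //.
by apply: measurableT_comp => //; apply: measurable_funM.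
Qed.

Let ergodic_m0 : ergodic_m set0 = 0%E.
Proof. by rewrite /ergodic_m integral_set0. Qed.

Let ergodic_m_ge0 A : (0 <= ergodic_m A)%E.
Proof. by apply: integral_ge0 => x _; rewrite lee_fin ergodic_density_ge0. Qed.

Let ergodic_m_sigma_additive : semi_sigma_additive ergodic_m.
Proof.
move=> /= A mA tA mUA; rewrite /ergodic_m ge0_integral_bigcup//=.
- apply: is_cvg_ereal_nneg_natsum_cond => n _ _; exact: ergodic_m_ge0.
- by apply/measurable_EFinP/measurable_funTS; exact: measurable_ergodic_density.
- by move=> x _; rewrite lee_fin ergodic_density_ge0.
Qed.

HB.instance Definition _ := isMeasure.Build _ _ _
  ergodic_m ergodic_m0 ergodic_m_ge0 ergodic_m_sigma_additive.

End ergodic.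

(* Main.v *)
(* The terminal condition phi_T = 2 Psi = sqrt C is the equilibrium of the
   Riccati equation, so phi = sqrt C on [0, T]. Then u(t, x) - u(t, 0) differs
   from the ergodic solution by chi_t x, its x-derivative by chi_t, and it
   remains to bound mu and chi. They solve a linear system with constant
   coefficients and eigenvalues +-sqrt (C - B), whose growing mode is controlled
   from T and whose decaying mode is controlled from 0, which gives the two
   exponentials. *)

Require Import Defs.
From mathcomp Require Import all_boot all_order all_algebra.
From mathcomp Require Import all_classical all_reals all_analysis.
From mathcomp Require Import measurable_realfun.
From mathcomp Require Import ring lra.

Set Implicit Arguments.
Unset Strict Implicit.
Unset Printing Implicit Defensive.

Import Order.TTheory GRing.Theory Num.Theory.
Import numFieldNormedType.Exports.

Local Open Scope classical_set_scope.
Local Open Scope ring_scope.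

(** * Scalar differential equations on a finite horizon *)

(** Replaces integration of the equation: the arguments below only use the sign or the vanishing of
    [F]. The point [c] lies in the closed interval, which also covers [a = b]. *)
Lemma ode_on_MVT {R : realType} (T : R) (y F : R -> R) (a b : R) :
  ode_on T y F -> 0 <= a -> a <= b -> b <= T ->
  exists2 c : R, c \in `[0, T] & y b - y a = F c * (b - a).
Proof.
move=> [yc yd] a0 ab bT.
have yd' (t : R) : t \in `]a, b[ -> is_derive t 1 y (F t).
  rewrite in_itv/= => /andP[at_ tb]; apply: yd.
  by rewrite in_itv/= (le_lt_trans a0)//= (lt_le_trans tb).
have yc' : {within `[a, b], continuous y}.
  apply: continuous_subspaceW yc => t /=; rewrite !in_itv/= => /andP[at_ tb].
  by rewrite (le_trans a0)//= (le_trans tb).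
have [c + yE] := @MVT_segment R y F a b ab yd' yc'.
rewrite in_itv/= => /andP[ac cb]; exists c => //.
by rewrite in_itv/= (le_trans a0)//= (le_trans cb).
Qed.

Lemma within_continuousM {T : topologicalType} {R : realType} (A : set T)
    (f g : T -> R) :
  {within A, continuous f} -> {within A, continuous g} ->
  {within A, continuous (fun x => f x * g x)}.
Proof. by move=> cf cg t; exact: (continuousM (cf t) (cg t)). Qed.

(** Integrating factor: a suitable [k] makes the new right-hand side vanish or have a constant
    sign. *)
Lemma ode_on_expM {R : realType} (T k : R) (y F : R -> R) : ode_on T y F ->
  ode_on T (fun t => expR (k * t) * y t)
    (fun t => expR (k * t) * (k * y t + F t)).
Proof.
move=> [yc yd]; split=> [|t tT].
  apply: within_continuousM; last exact: yc.
  apply: continuous_subspaceT => {}t.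
  apply: (@continuous_comp _ _ _ ( *%R k) expR); last exact: continuous_expR.
  exact: mulrl_continuous.
have dy := yd t tT.
apply: is_derive_eq.
by rewrite /GRing.scale/=; ring.
Qed.

Lemma ode_on_lincomb {R : realType} (T a b : R) (y F z G : R -> R) :
  ode_on T y F -> ode_on T z G ->
  ode_on T (fun t => a * y t + b * z t) (fun t => a * F t + b * G t).
Proof.
move=> [yc yd] [zc zd]; split=> [|t tT].
  by apply: within_continuousD; apply: within_continuousM => // ?;
    exact: cvg_cst.
have dy := yd t tT; have dz := zd t tT.
apply: is_derive_eq.
by rewrite /GRing.scale/=; ring.
Qed.

Lemma ode_on_sqr {R : realType} (T : R) (y F : R -> R) :
  ode_on T y F -> ode_on T (fun t => y t ^+ 2) (fun t => 2 * F t * y t).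
Proof.
move=> [yc yd]; split=> [|t tT].
  exact: within_continuousM.
have dy := yd t tT.
apply: is_derive_eq.
by rewrite /GRing.scale/=; ring.
Qed.

Lemma eq_ode_on {R : realType} (T : R) (y F G : R -> R) :
  {in `]0, T[, F =1 G} -> ode_on T y F -> ode_on T y G.
Proof. by move=> FG [yc yd]; split=> // t tT; rewrite -FG//; exact: yd. Qed.

(** After multiplication by [expR (- k * t)] the derivative is zero, so the product takes the same
    value at [s] and [t]. Both times are free because growing modes are read from [T] and decaying
    ones from [0]. *)
Lemma ode_on_linear {R : realType} (T k : R) (y : R -> R) (s t : R) :
  ode_on T y (fun t => k * y t) -> 0 <= s -> s <= t -> t <= T ->
  y t = expR (k * (t - s)) * y s.
Proof.
move=> /(ode_on_expM (- k)) y_ode s0 st tT.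
have [c _] := ode_on_MVT y_ode s0 st tT.
rewrite -mulrDl addNr mul0r mulr0 mul0r => /eqP; rewrite subr_eq0 => /eqP yE.
have -> : expR (k * (t - s)) = expR (k * t) * expR (- k * s).
  by rewrite -expRD; congr expR; ring.
by rewrite -mulrA -yE mulrA -expRD mulNr subrr expR0 mul1r.
Qed.

(* Gronwall: [expR (2 * M * t) * w t ^+ 2] is nondecreasing and vanishes at
   [T]. *)
Lemma ode_on_linear_eq0 {R : realType} (T M : R) (w a : R -> R) (t : R) :
  ode_on T w (fun t => a t * w t) ->
  (forall t, t \in `[0, T] -> - M <= a t) ->
  w T = 0 -> t \in `[0, T] -> w t = 0.
Proof.
move=> /ode_on_sqr/(ode_on_expM (2 * M)) w_ode aM wT.
rewrite in_itv/= => /andP[t0 tT].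
have [c cT] := ode_on_MVT w_ode t0 tT (lexx T).
rewrite wT expr0n mulr0 sub0r => wE.
have : 0 <= - (expR (2 * M * t) * w t ^+ 2).
  rewrite wE mulr_ge0 ?subr_ge0// mulr_ge0 ?expR_ge0//.
  rewrite (_ : _ + _ = 2 * (a c + M) * w c ^+ 2); last by ring.
  by rewrite mulr_ge0 ?sqr_ge0// mulr_ge0// -lerBlDr sub0r aM.
rewrite oppr_ge0 pmulr_rle0 ?expR_gt0// => w0.
by apply/eqP; rewrite -sqrf_eq0 eq_le w0 sqr_ge0.
Qed.

(** Since [phi ^+ 2 - C] factors as [(phi + Num.sqrt C) * (phi - Num.sqrt C)], the gap
    [phi - Num.sqrt C] solves a linear equation with zero terminal value. *)
Lemma riccati_stationary {R : realType} (T C : R) (phi : R -> R) :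
  0 <= C -> 0 <= T -> ode_on T phi (fun t => phi t ^+ 2 - C) ->
  phi T = Num.sqrt C -> forall t, t \in `[0, T] -> phi t = Num.sqrt C.
Proof.
move=> C0 T0 phi_ode phiT t tT; apply/eqP; rewrite -subr_eq0; apply/eqP.
(* The minimum of [phi] on the compact horizon bounds the coefficient [phi + Num.sqrt C] from
   below. *)
have [c _ phic] := EVT_min T0 phi_ode.1.
apply: (@ode_on_linear_eq0 R T (- phi c) (fun t => phi t - Num.sqrt C)
  (fun t => phi t + Num.sqrt C)) => //.
- case: phi_ode => phi_c phi_d; split=> [|s sT].
    by apply: within_continuousB => // s; exact: cvg_cst.
  have := phi_d s sT => dphi; apply: is_derive_eq.
  rewrite subr0 -[X in _ - X](sqr_sqrtr C0); ring.
- by move=> s /phic; have := sqrtr_ge0 C; lra.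
- by rewrite phiT subrr.
Qed.

(** * The forward-backward linear system for [mu] and [chi] *)

(** The coefficient matrix has trace [0] and determinant [- lambda ^+ 2]. It is used with
    [c = Num.sqrt C] and [lambda = Num.sqrt (C - B)], so that [c ^+ 2 - lambda ^+ 2 = B]. *)
Lemma linear_system_bound {R : realType} (c lambda r mu0 : R) :
  0 < c -> 0 < lambda -> exists2 K : R, 0 <= K &
  forall (T : R) (mu chi : R -> R), 0 <= T ->
    ode_on T mu (fun t => - (c * mu t + chi t)) ->
    ode_on T chi (fun t => c * chi t + (c ^+ 2 - lambda ^+ 2) * mu t) ->
    mu 0 = mu0 -> chi T = - (c * r) ->
  forall t, t \in `[0, T] ->
  let E := expR (- (lambda * t)) + expR (- (lambda * (T - t))) in
  `|mu t| <= K * E /\ `|chi t| <= K * E.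
Proof.
move=> c0 l0.
(* [2 * lambda * N] is the bound on [p T] proved below plus [2 * lambda * |mu0|], hence dominates
   both [p T] and [q 0]. Going back to the unknowns costs a factor [1] for [mu] and [c + lambda] for
   [chi]. *)
pose N := (lambda * `|mu0| + c * `|r| + `|c - lambda| * `|mu0|) / lambda.
have N0 : 0 <= N by rewrite divr_ge0 ?(ltW l0)// !addr_ge0// mulr_ge0// ltW.
exists ((1 + c + lambda) * N); first by rewrite mulr_ge0//; lra.
move=> T mu chi T0 mu_ode chi_ode muE chiE t tE E.
have /andP[t0 tT] : 0 <= t <= T by rewrite in_itv in tE.
(* [p] and [q] are the coordinates given by the left eigenvectors of the
   system, with eigenvalues [lambda] and [- lambda]; the two boundary
   conditions bound [p T] and [q 0] uniformly in [T]. *)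
pose p t := (c - lambda) * mu t + 1 * chi t.
pose q t := (c + lambda) * mu t + 1 * chi t.
have p_ode : ode_on T p (fun t => lambda * p t).
  apply: eq_ode_on (ode_on_lincomb _ _ mu_ode chi_ode) => s _.
  rewrite /p; ring.
have q_ode : ode_on T q (fun t => - lambda * q t).
  apply: eq_ode_on (ode_on_lincomb _ _ mu_ode chi_ode) => s _.
  rewrite /q; ring.
have pE s : 0 <= s -> s <= T -> p s = expR (- (lambda * (T - s))) * p T.
  move=> s0 sT; rewrite (ode_on_linear p_ode s0 sT (lexx T)).
  by rewrite mulrA -expRD addNr expR0 mul1r.
have qE s : 0 <= s -> s <= T -> q s = expR (- (lambda * s)) * q 0.
  move=> s0 sT; rewrite (ode_on_linear q_ode (lexx 0) s0 sT).
  by rewrite subr0 mulNr.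
have pT : `|p T| <= 2 * c * `|r| + 2 * `|c - lambda| * `|mu0|.
  set e := expR (- (lambda * T)).
  have e0 : 0 < e by exact: expR_gt0.
  have e1 : e <= 1 by rewrite -[leRHS]expR0 ler_expR oppr_le0 mulr_ge0// ltW.
  have := pE 0 (lexx 0) T0; rewrite subr0 -/e => p0E.
  have := qE T T0 (lexx T); rewrite -/e => qTE.
  (* [D] equals [(c + lambda) - (c - lambda) * e ^+ 2], the coefficient of [p T] once [q 0] is
     eliminated from the two boundary conditions. The form chosen shows [D >= lambda] for every [T],
     even when [c < lambda]. *)
  pose D := c * (1 - e ^+ 2) + lambda * (1 + e ^+ 2).
  have e21 : e ^+ 2 <= 1 by rewrite expr_le1// ltW.
  have Dl : lambda <= D.
    by rewrite /D -[leLHS]add0r lerD// ?mulr_ge0 ?(ltW c0) ?subr_ge0//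
      ler_peMr ?(ltW l0)// lerDl sqr_ge0.
  have pTD : p T * D = lambda * (- (2 * c * r) + 2 * (c - lambda) * mu0 * e).
    have chiT : chi T * (2 * lambda) = (c + lambda) * p T - (c - lambda) * q T.
      by rewrite /p /q; ring.
    have mu00 : mu 0 * (2 * lambda) = q 0 - p 0 by rewrite /p /q; ring.
    move: chiT mu00; rewrite chiE muE qTE p0E => chiT mu00.
    have q0E : q 0 = mu0 * (2 * lambda) + e * p T by rewrite mu00; ring.
    rewrite q0E in chiT.
    transitivity (- (c * r) * (2 * lambda)
        + 2 * lambda * (c - lambda) * mu0 * e); last by ring.
    by rewrite chiT /D; ring.
  rewrite -(ler_pM2r l0).
  apply: (@le_trans _ _ (`|p T| * D)); first by rewrite ler_wpM2l.
  rewrite -[X in _ * X]gtr0_norm; last by rewrite (lt_le_trans l0).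
  rewrite -normrM pTD normrM gtr0_norm// mulrC ler_wpM2r ?(ltW l0)//.
  rewrite (le_trans (ler_normD _ _))// lerD//.
    by rewrite normrN normrM gtr0_norm// mulr_gt0.
  by rewrite !normrM normr_nat (gtr0_norm e0) ler_piMr// !mulr_ge0.
have NE : 2 * lambda * N =
    2 * lambda * `|mu0| + (2 * c * `|r| + 2 * `|c - lambda| * `|mu0|).
  rewrite /N; field; exact: lt0r_neq0.
have mu0_ge0 : 0 <= 2 * lambda * `|mu0| by rewrite !mulr_ge0// ltW.
have pTN : `|p T| <= 2 * lambda * N by lra.
have q0 : `|q 0| <= 2 * lambda * N.
  (* At time [0] the coordinate [p] is at most [p T] in absolute value, so the initial condition
     transfers the bound to [q 0]. *)
  have -> : q 0 = 2 * lambda * mu0 + p 0 by rewrite -muE /p /q; ring.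
  rewrite NE (le_trans (ler_normD _ _))// lerD//.
    by rewrite normrM gtr0_norm// mulr_gt0.
  apply: le_trans pT; rewrite (pE 0)// normrM (ger0_norm (expR_ge0 _)).
  by rewrite ler_piMl// -[leRHS]expR0 ler_expR oppr_le0 subr0 mulr_ge0// ltW.
have pN : `|p t| <= 2 * lambda * N * expR (- (lambda * (T - t))).
  by rewrite pE// normrM (ger0_norm (expR_ge0 _)) mulrC ler_wpM2r ?expR_ge0.
have qN : `|q t| <= 2 * lambda * N * expR (- (lambda * t)).
  by rewrite qE// normrM (ger0_norm (expR_ge0 _)) mulrC ler_wpM2r ?expR_ge0.
have pq : `|p t| + `|q t| <= 2 * lambda * (N * E) by rewrite /E; lra.
have E0 : 0 <= E by rewrite addr_ge0 ?expR_ge0.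
have NE0 : 0 <= N * E by exact: mulr_ge0.
have muN : `|mu t| <= N * E.
  rewrite -(@ler_pM2l _ (2 * lambda)) ?mulr_gt0//; apply: le_trans pq.
  rewrite -{1}(@gtr0_norm _ (2 * lambda)) ?mulr_gt0// -normrM.
  rewrite (_ : _ * mu t = q t - p t); last by rewrite /p /q; ring.
  by rewrite (le_trans (ler_normB _ _))// addrC.
have chiN : `|chi t| <= (c + lambda) * (N * E).
  rewrite -(@ler_pM2l _ (2 * lambda)) ?mulr_gt0//.
  rewrite -{1}(@gtr0_norm _ (2 * lambda)) ?mulr_gt0// -normrM.
  rewrite (_ : _ * chi t = (c + lambda) * p t - (c - lambda) * q t); last first.
    by rewrite /p /q; ring.
  have cl : `|c - lambda| <= c + lambda by rewrite ler_norml; lra.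
  apply: (@le_trans _ _ ((c + lambda) * (`|p t| + `|q t|))).
    rewrite (le_trans (ler_normB _ _))// !normrM mulrDr.
    by rewrite (@gtr0_norm _ (c + lambda)) ?addr_gt0// lerD2l ler_wpM2r.
  by rewrite [leRHS]mulrCA ler_wpM2l// addr_ge0// ltW.
split.
  by apply: (le_trans muN); rewrite -mulrA ler_peMl//; lra.
apply: (le_trans chiN); rewrite -mulrA ler_wpM2r//; lra.
Qed.

(** * Gaussian integrals and the ergodic measure *)

(** The change of variables holds for the Radon-Nikodym derivative, which agrees almost everywhere
    with [normal_pdf] because both have the same integral over every measurable set. *)
Lemma ge0_integral_normal_prob {R : realType} (m s : R) (f : R -> \bar R) :
  (forall x, (0 <= f x)%E) -> measurable_fun setT f ->
  (\int[normal_prob m s]_x f x =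
   \int[lebesgue_measure]_x (f x * (normal_pdf m s x)%:E))%E.
Proof.
move=> f0 mf.
pose nu : {finite_measure set (measurableTypeR R) -> \bar R} := normal_prob m s.
pose g := Radon_Nikodym_SigmaFinite.f nu lebesgue_measure.
have numu : nu `<< lebesgue_measure by exact: normal_prob_dominates.
have gi : lebesgue_measure.-integrable setT g.
  exact: Radon_Nikodym_SigmaFinite.f_integrable.
have mpdf : measurable_fun setT (EFin \o normal_pdf m s).
  by apply/measurable_EFinP; exact: measurable_normal_pdf.
rewrite -[LHS]/(\int[nu]_x f x)%E.
rewrite -(Radon_Nikodym_SigmaFinite.change_of_variables numu f0 measurableT mf).
apply: ae_eq_integral => //.
- by apply: emeasurable_funM => //; exact: measurable_int gi.
- exact: emeasurable_funM.
- apply: ae_eqe_mul2l; apply: integral_ae_eq => //.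
  by move=> A _ mA; rewrite -Radon_Nikodym_SigmaFinite.f_integral.
Qed.

Lemma normal_prob_abs_moment_lty {R : realType} (s : R) : s != 0 ->
  (\int[normal_prob 0 s]_x (`|x|)%:E < +oo)%E.
Proof.
move=> s0; rewrite ge0_integral_normal_prob//; last first.
  by apply/measurable_EFinP; exact: normr_measurable.
(* [`|x|] is absorbed by passing to the Gaussian of standard deviation
   [2 * s]. *)
have s20 : 2 * s != 0 by rewrite mulf_neq0.
(* [M] makes [|x| <= M * (1 + y) <= M * expR y], where [y] below is the gap between the exponents of
   the two Gaussians; [K] adds the ratio of their peaks. *)
pose M : R := 1 + 8 * s ^+ 2 / 3.
pose K := M * normal_peak s / normal_peak (2 * s).
have K0 : 0 <= K.
  rewrite /K /M divr_ge0 ?normal_peak_ge0// mulr_ge0 ?normal_peak_ge0//.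
  by rewrite addr_ge0// divr_ge0// mulr_ge0// sqr_ge0.
apply: (@le_lt_trans _ _
    (\int[lebesgue_measure]_x (K%:E * (normal_pdf 0 (2 * s) x)%:E))%E).
  apply: ge0_le_integral => //.
  - by move=> x _; rewrite mule_ge0 ?lee_fin// normal_pdf_ge0.
  - apply: emeasurable_funM; apply/measurable_EFinP.
      exact: normr_measurable.
    exact: measurable_normal_pdf.
  - apply: emeasurable_funM => //; apply/measurable_EFinP.
    exact: measurable_normal_pdf.
  move=> x _; rewrite -!EFinM lee_fin !normal_pdfE//.
  have -> : K * (normal_peak (2 * s) * normal_fun 0 (2 * s) x) =
      normal_peak s * (M * normal_fun 0 (2 * s) x).
    by rewrite /K; field; rewrite gt_eqF// normal_peak_gt0.
  rewrite mulrCA ler_wpM2l ?normal_peak_ge0// /normal_fun subr0.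
  pose y := 3 * x ^+ 2 / (8 * s ^+ 2).
  have -> : - x ^+ 2 / ((2 * s) ^+ 2 *+ 2) = y + - x ^+ 2 / (s ^+ 2 *+ 2).
    by rewrite /y; field.
  rewrite expRD mulrA ler_wpM2r ?expR_ge0//.
  have y0 : 0 <= y by rewrite divr_ge0// mulr_ge0// sqr_ge0.
  apply: (@le_trans _ _ (M * (1 + y))); last first.
    rewrite ler_wpM2l ?expR_ge1Dx// /M.
    by rewrite addr_ge0// divr_ge0// mulr_ge0// sqr_ge0.
  have -> : M * (1 + y) = 1 + x ^+ 2 + (y + 8 * s ^+ 2 / 3).
    by rewrite /M /y; field.
  have : 0 <= 8 * s ^+ 2 / 3 by rewrite divr_ge0// mulr_ge0// sqr_ge0.
  (* This square yields [2 * |x| <= 1 + x ^+ 2]. *)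
  have := sqr_ge0 (`|x| - 1); have := normr_ge0 x.
  have := real_normK (num_real x).
  nra.
rewrite integralZl//; last exact: integrable_normal_pdf.
by rewrite integral_normal_pdf mule1 ltry.
Qed.

(** The densities agree pointwise. As [normal_prob] takes a standard deviation, its parameter is the
    square root of the variance [sigma ^+ 2 / (2 * Num.sqrt C)]. *)
Lemma ergodic_mE {R : realType} (C sigma : R) (A : set R) :
  0 < C -> 0 < sigma ->
  ergodic_m C sigma A = normal_prob 0 (sigma / Num.sqrt (2 * Num.sqrt C)) A.
Proof.
move=> C0 s0; rewrite /ergodic_m /normal_prob; apply: eq_integral => x _.
have c0 : 0 < Num.sqrt C by rewrite sqrtr_gt0.
have v0 : sigma / Num.sqrt (2 * Num.sqrt C) != 0.
  by rewrite mulf_neq0 ?invr_eq0 ?gt_eqF// sqrtr_gt0 mulr_gt0.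
have vE : (sigma / Num.sqrt (2 * Num.sqrt C)) ^+ 2 =
    sigma ^+ 2 / (2 * Num.sqrt C).
  by rewrite expr_div_n sqr_sqrtr// mulr_ge0// ltW.
rewrite normal_pdfE// /normal_peak /normal_fun vE subr0 /ergodic_density.
congr (_%:E); rewrite div1r; congr (_^-1 * expR _).
  by congr Num.sqrt; field; rewrite gt_eqF.
by field; rewrite !gt_eqF.
Qed.

(** * Exponential estimates for the mean field game *)

Theorem proposition4p1 (R : realType) (Q B Psi r mu0 sigma : R)
    (C := Q + B) (hQ : 0 < Q) (hC : 0 < C) (hPsi : Num.sqrt C = 2 * Psi)
    (hsigma : 0 < sigma) :
  exists2 K : R, 0 < K &
    forall (sigma0 T : R) (u : R -> R -> R)
      (m : R -> probability (measurableTypeR R) R),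
      0 < sigma0 -> 0 < T ->
      quadratic_mfg_solution Q B Psi r mu0 sigma sigma0 T u m ->
      forall t : R, t \in `[0, T] ->
        let E := expR (- (Num.sqrt (C - B) * t))
                 + expR (- (Num.sqrt (C - B) * (T - t))) in
        [/\ (\int[ergodic_m C sigma]_x
               (`|u t x - u t 0 - ergodic_u C x|)%:E <= (K * E)%:E)%E,
            (\int[ergodic_m C sigma]_x
               (`|d_x u t x - derive1 (ergodic_u C) x|)%:E <= (K * E)%:E)%E
          & `|mean (m t)| <= K * E].
Proof.
have CBE : C - B = Q by rewrite /C addrK.
have c0 : 0 < Num.sqrt C by rewrite sqrtr_gt0.
have l0 : 0 < Num.sqrt (C - B) by rewrite sqrtr_gt0 CBE.
have [K1 K10 K1P] := linear_system_bound r mu0 c0 l0.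
pose s := sigma / Num.sqrt (2 * Num.sqrt C).
have s0 : s != 0 by rewrite mulf_neq0 ?invr_eq0 ?gt_eqF// sqrtr_gt0 mulr_gt0.
have mE f : (\int[ergodic_m C sigma]_x f x = \int[normal_prob 0 s]_x f x)%E.
  by apply: eq_measure_integral => A _ _; exact: ergodic_mE.
pose M := (\int[normal_prob 0 s]_x (`|x|)%:E)%E.
have M0 : (0 <= M)%E by apply: integral_ge0 => x _; rewrite lee_fin.
have ME : M = (fine M)%:E.
  by rewrite fineK// ge0_fin_numE//; exact: normal_prob_abs_moment_lty.
have fM0 : 0 <= fine M by exact: fine_ge0.
(* [K1] serves [mu] and [chi], and [K1 * fine M] the integral of [|chi t * x|]; the final [1] gives
   strict positivity, as [K1] may be zero. *)
exists (K1 * (1 + fine M) + 1); first by rewrite ltr_wpDl// mulr_ge0// addr_ge0.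
move=> sigma0 T u m _ T0 [_ [mu [phi [chi [psi [odes muE uE]]]]]] t tT E.
have phiE : {in `[0, T], phi =1 cst (Num.sqrt C)}.
  apply: riccati_stationary; [exact: ltW|exact: ltW|exact: ode_phi odes|].
  by rewrite (ode_phiT odes) hPsi.
have phiE' : {in `]0, T[, phi =1 cst (Num.sqrt C)}.
  by move=> x xT; apply: phiE; exact: subset_itv_oo_cc xT.
have [] := K1P T mu chi (ltW T0) _ _ _ _ t tT.
- by apply: eq_ode_on (ode_mu odes) => x /phiE' ->.
- apply: eq_ode_on (ode_chi odes) => x /phiE' ->.
  by rewrite !sqr_sqrtr// ?CBE ?(ltW hQ) ?(ltW hC)// /C addrAC subrr add0r.
- exact: ode_mu0 odes.
- by rewrite (ode_chiT odes) hPsi.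
rewrite -/E => mu_bound chi_bound.
have E0 : 0 <= E by rewrite addr_ge0 ?expR_ge0.
have KE0 : 0 <= K1 * E by exact: mulr_ge0.
(* An equality of functions of [x] at fixed [t], valid also at [t = 0] and [t = T], so it can be
   differentiated in [x] at the end points of the horizon. *)
have u_quad : u t = (fun x => 2^-1 * Num.sqrt C * x ^+ 2 + chi t * x + psi t).
  by apply/funext => x; rewrite uE// phiE.
split.
- rewrite mE (_ : (fun x => _) = (fun x => `|chi t|%:E * `|x|%:E)%E); last first.
    apply/funext => x; rewrite u_quad /ergodic_u -EFinM -normrM.
    by congr (`|_|%:E); ring.
  rewrite ge0_integralZl//; last first.
    by apply/measurable_EFinP; exact: normr_measurable.
  rewrite -/M ME -EFinM lee_fin.
  apply: (@le_trans _ _ (K1 * E * fine M)); first by rewrite ler_wpM2r.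
  have : 0 <= K1 * E * fine M by exact: mulr_ge0.
  lra.
- rewrite mE (_ : (fun x => _) = cst `|chi t|%:E); last first.
    apply/funext => x; rewrite /cst /d_x u_quad !derive1E.
    have du : is_derive x (1 : R)
        (fun x => 2^-1 * Num.sqrt C * x ^+ 2 + chi t * x + psi t)
        (Num.sqrt C * x + chi t).
      by apply: is_derive_eq; rewrite /GRing.scale/=; field.
    have de : is_derive x (1 : R) (ergodic_u C) (Num.sqrt C * x).
      by apply: is_derive_eq; rewrite /GRing.scale/=; field.
    by rewrite !derive_val; congr (`|_|%:E); ring.
  rewrite integral_cst//.
  rewrite [X in (_ * X)%E](@probability_setT _ _ _ (normal_prob 0 s)).
  rewrite mule1 lee_fin (le_trans chi_bound)//.
  have : 0 <= K1 * E * fine M by exact: mulr_ge0.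
  lra.
- rewrite -muE// (le_trans mu_bound)//.
  have : 0 <= K1 * E * fine M by exact: mulr_ge0.
  lra.
Qed.
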